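(* Let $\Phi$ be an associative commutative ring with $1$ and let $A$ be a finitely generated associative commutative $\Phi$-algebra. Suppose that $A$ does not have additive torsion. Then: (a) every finitely generated subgroup of the group $\mathrm{Aut}(A)$ is virtually torsion free; (b) if $A$ is a finitely generated ring (i.e. $\Phi=\mathbb{Z}$), then the group $\mathrm{Aut}(A)$ is virtually torsion free.
   Context: Algebras are taken with $1$. ''Finitely generated'' means finitely generated as a $\Phi$-algebra (as a ring, when $\Phi=\mathbb{Z}$). $\mathrm{Aut}(A)$ is the group of $\Phi$-linear algebra automorphisms of $A$. $A$ does not have additive torsion if $na=0$ with $a\in A$ and an integer $n\ge 1$ implies $a=0$. A group is virtually torsion free if it has a subgroup of finite index that is torsion free (its only element of finite order is the identity). *)

(* Defs.v *)
From HB Require Import structures.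
From mathcomp Require Import all_boot all_algebra.
From mathcomp Require Import boolp.

Set Implicit Arguments.
Unset Strict Implicit.
Unset Printing Implicit Defensive.

Import GRing.Theory.
Local Open Scope ring_scope.

(* A commutative Phi-algebra A is given by its structure morphism
   iota : {rmorphism Phi -> A}, the scalar action being c . x := iota c * x.
   Unlike comAlgType, this allows A (and Phi) to be the zero ring. *)

Definition finitely_generated_alg (Phi A : comPzRingType)
    (iota : {rmorphism Phi -> A}) : Prop :=
  exists s : seq A, forall B : {pred A},
    subring_closed B ->
    (forall c x, x \in B -> iota c * x \in B) ->
    {subset s <= B} ->
    forall x, x \in B.

Definition no_additive_torsion (A : zmodType) : Prop :=
  forall (n : nat) (a : A), (0 < n)%N -> a *+ n = 0 -> a = 0.

Definition is_alg_aut (Phi A : comPzRingType) (iota : {rmorphism Phi -> A})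
    (f : A -> A) : Prop :=
  [/\ zmod_morphism f, monoid_morphism f,
      forall c x, f (iota c * x) = iota c * f x
    & bijective f].

Record algAut (Phi A : comPzRingType) (iota : {rmorphism Phi -> A}) : Type :=
  AlgAut {
    alg_aut_fun :> A -> A;
    algAutP : is_alg_aut iota alg_aut_fun
  }.

Section AlgAutGroup.
Context (Phi A : comPzRingType) (iota : {rmorphism Phi -> A}).
Local Notation Aut := (algAut iota).
Implicit Types f g h : Aut.

Lemma algAut_ext f g : f =1 g -> f = g.
Proof.
case: f g => [f fP] [g gP] /= /funext fg; subst g.
by congr AlgAut; exact: Prop_irrelevance.
Qed.

HB.instance Definition _ := gen_eqMixin Aut.
HB.instance Definition _ := gen_choiceMixin Aut.

Lemma is_alg_aut_id : is_alg_aut iota id.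
Proof. by split=> //; exact: (Bijective (g := id)). Qed.

Lemma is_alg_aut_comp f g : is_alg_aut iota (f \o g).
Proof.
case: (algAutP f) (algAutP g) => fB [f1 fM] fZ fbij [gB [g1 gM] gZ gbij]; split.
- by move=> x y /=; rewrite gB fB.
- by split=> [|x y] /=; rewrite ?g1 ?f1 // gM fM.
- by move=> c x /=; rewrite gZ fZ.
- exact: bij_comp.
Qed.

Lemma algAut_inv_ex f : exists g : A -> A, cancel f g /\ cancel g f.
Proof. by case: (algAutP f) => _ _ _ [g fK gK]; exists g. Qed.

Definition alg_aut_inv_fun f : A -> A := sval (cid (algAut_inv_ex f)).

Lemma alg_aut_inv_funK f : cancel f (alg_aut_inv_fun f).
Proof. by case: (svalP (cid (algAut_inv_ex f))). Qed.

Lemma alg_aut_inv_funVK f : cancel (alg_aut_inv_fun f) f.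
Proof. by case: (svalP (cid (algAut_inv_ex f))). Qed.

Lemma is_alg_aut_inv f : is_alg_aut iota (alg_aut_inv_fun f).
Proof.
have fI := can_inj (alg_aut_inv_funK f).
have fK := alg_aut_inv_funVK f.
case: (algAutP f) => fB [f1 fM] fZ _; split.
- by move=> x y; apply: fI; rewrite fB !fK.
- by split=> [|x y]; apply: fI; rewrite ?f1 ?fM !fK.
- by move=> c x; apply: fI; rewrite fZ !fK.
- exact: Bijective fK (alg_aut_inv_funK f).
Qed.

Definition algAut_one : Aut := AlgAut is_alg_aut_id.
Definition algAut_mul f g : Aut := AlgAut (is_alg_aut_comp f g).
Definition algAut_inv f : Aut := AlgAut (is_alg_aut_inv f).

Lemma algAut_mulA : associative algAut_mul.
Proof. by move=> f g h; exact: algAut_ext. Qed.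

Lemma algAut_mul1g : left_id algAut_one algAut_mul.
Proof. by move=> f; exact: algAut_ext. Qed.

Lemma algAut_mulg1 : right_id algAut_one algAut_mul.
Proof. by move=> f; exact: algAut_ext. Qed.

Lemma algAut_mulVg : left_inverse algAut_one algAut_inv algAut_mul.
Proof. by move=> f; apply: algAut_ext => x; exact: alg_aut_inv_funK. Qed.

Lemma algAut_mulgV : right_inverse algAut_one algAut_inv algAut_mul.
Proof. by move=> f; apply: algAut_ext => x; exact: alg_aut_inv_funVK. Qed.

HB.instance Definition _ := isGroup.Build Aut
  algAut_mulA algAut_mul1g algAut_mulg1 algAut_mulVg algAut_mulgV.

End AlgAutGroup.

(* Subgroups of a (possibly infinite) group G are represented as predicates
   H : {pred G} with group_closed H. *)

Definition finitely_generated_subgroup (G : groupType) (H : {pred G}) : Prop :=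
  exists s : seq G, {subset s <= H} /\
    forall K : {pred G}, group_closed K -> {subset s <= K} -> {subset H <= K}.

(* The left cosets t K, for t in the list, cover H. *)
Definition finite_index (G : groupType) (K H : {pred G}) : Prop :=
  exists s : seq G, {subset s <= H} /\
    {in H, forall g, exists2 t, t \in s & (t^-1 * g)%g \in K}.

Definition torsion_free (G : groupType) (K : {pred G}) : Prop :=
  {in K, forall g (n : nat), (0 < n)%N -> (g ^+ n)%g = 1%g -> g = 1%g}.

Definition virtually_torsion_free (G : groupType) (H : {pred G}) : Prop :=
  exists K : {pred G},
    [/\ group_closed K, {subset K <= H}, finite_index K H & torsion_free K].

(* Main.v *)
Require Import Defs.
From HB Require Import structures.
From mathcomp Require Import all_boot all_algebra all_field.
From mathcomp Require Import boolp ring zify.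

Set Implicit Arguments.
Unset Strict Implicit.
Unset Printing Implicit Defensive.

Import GRing.Theory.
Local Open Scope ring_scope.

(** A finitely generated commutative ring [A] has enough ideals of finite index
    to detect automorphisms of finite order, and this bounds the torsion.

    Let [M] be an ideal of finite index containing a prime [p]. Since [A] is
    noetherian, [M ^ 2] has finite index too, and the automorphisms acting
    trivially modulo [M ^ 2] form a subgroup of finite index. Let [sigma] be
    one of them, of prime order [q <> p], and let [D] be the ideal generated by
    all [delta x = sigma x - x]. Then [D] is contained in [M ^ 2], and the
    Leibniz rule gives [delta (M ^ 2)] inside [M D]; so [delta (delta x)] is in
    [M D], and expanding [sigma ^ q = (1 + delta) ^ q] shows that [q * delta x]
    is in [M D]. As [q] is invertible modulo [p], [D = M D], and by Nakayama's
    lemma some [1 - e] with [e] in [M] annihilates [D]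
    ([annihilated_displacement]).

    To get a contradiction when [sigma] is not the identity, [M] must not be
    comaximal with the annihilator of any nonzero [d]. If [A] has no additive
    torsion, such an [M] exists for all but finitely many [p]
    ([separable_ideal]). By noetherian induction on ideals the claim reduces to
    a domain [A / P] of characteristic zero, where it amounts to the
    existence of a proper ideal of finite index containing [p], that is, to the
    Nullstellensatz over the integers. The latter is proved for iterated
    polynomial rings over the integers by extending a homomorphism to an
    algebraically closed field one variable at a time
    ([specializable_poly]), the values being algebraic over the prime field
    ([exists_closed_field_pchar]) and hence in a finite field
    ([cofinite_ker]). Using two primes [p] takes care of every [q]
    ([virtually_torsion_free_action]).

    For an arbitrary [Phi], a finitely generated group of automorphisms
    preserves the subring generated by the generators of [A] and by finitely
    many scalars, and acts faithfully on it ([virtually_torsion_free_fg]). *)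

(** * Ideals and the Hilbert basis theorem *)

Record is_ideal (A : comPzRingType) (I : A -> Prop) : Prop := IsIdeal {
  ideal0 : I 0;
  idealD : forall x y, I x -> I y -> I (x + y);
  idealMl : forall a x, I x -> I (a * x)
}.

Section Ideals.
Context (A : comPzRingType).
Implicit Types (I J : A -> Prop) (l : seq A).

Lemma idealN I x : is_ideal I -> I x -> I (- x).
Proof. by move=> idI Ix; rewrite -mulN1r; apply: idealMl idI _ _ Ix. Qed.

Lemma idealB I x y : is_ideal I -> I x -> I y -> I (x - y).
Proof. by move=> idI Ix Iy; apply: (idealD idI Ix); apply: idealN. Qed.

Lemma idealMr I x a : is_ideal I -> I x -> I (x * a).
Proof. by move=> idI Ix; rewrite mulrC; apply: idealMl idI _ _ Ix. Qed.

Lemma idealBl I x y : is_ideal I -> I y -> I (x - y) -> I x.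
Proof. by move=> idI Iy Ixy; rewrite -(subrK y x); apply: (idealD idI). Qed.

Lemma ideal_cap I J : is_ideal I -> is_ideal J -> is_ideal (fun x => I x /\ J x).
Proof.
move=> [I0 ID IM] [J0 JD JM]; split=> // [x y [Ix Jx] [Iy Jy]|a x [Ix Jx]].
  by split; [apply: ID | apply: JD].
by split; [apply: IM | apply: JM].
Qed.

Fixpoint span l (x : A) : Prop :=
  if l is g :: l' then exists r, span l' (x - r * g) else x = 0.

Lemma span_ideal l : is_ideal (span l).
Proof.
elim: l => [|g l [l0 lD lM]] /=; split=> //.
- by move=> x y -> ->; rewrite addr0.
- by move=> a x ->; rewrite mulr0.
- by exists 0; rewrite mul0r subr0.
- move=> x y [r lx] [s ly]; exists (r + s).
  by rewrite mulrDl opprD addrACA; apply: lD.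
- by move=> a x [r lx]; exists (a * r); rewrite -mulrA -mulrBr; apply: lM.
Qed.

Lemma mem_span l x : x \in l -> span l x.
Proof.
elim: l => //= g l IHl; rewrite inE => /predU1P[->|lx].
  by exists 1; rewrite mul1r subrr; apply: ideal0 (span_ideal l).
by exists 0; rewrite mul0r subr0; apply: IHl.
Qed.

Lemma span_min l J x :
  is_ideal J -> (forall y, y \in l -> J y) -> span l x -> J x.
Proof.
move=> idJ; elim: l x => [|g l IHl] x /= lJ; first by move->; apply: ideal0 idJ.
case=> r /IHl-/(_ (fun y ly => lJ y (mem_behead (s := g :: l) ly))) Jxr.
apply: (idealBl idJ _ Jxr); apply: (idealMl idJ); apply: lJ.
exact: mem_head.
Qed.

Definition noetherian : Prop :=
  forall I, is_ideal I -> exists l, forall x, I x <-> span l x.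

(** The ascending chain condition, in the form of an induction principle: a
    property of ideals which failed somewhere would fail along a strictly
    increasing sequence of ideals, whose union is not finitely generated. *)
Lemma noetherian_ind (Q : (A -> Prop) -> Prop) : noetherian ->
  (forall I, is_ideal I ->
     (forall J, is_ideal J -> (forall x, I x -> J x) ->
        (exists2 x, J x & ~ I x) -> Q J) -> Q I) ->
  forall I, is_ideal I -> Q I.
Proof.
move=> noethA IH I idI; apply: contrapT => nQI.
pose T := {J | is_ideal J /\ ~ Q J}.
pose R (J K : T) := (forall x, sval J x -> sval K x) /\
                    exists2 x, sval K x & ~ sval J x.
have step (J : T) : {K | R J K}.
  apply: cid; case: J => J [idJ nQJ]; apply: contrapT => nK.
  apply: (nQJ); apply: (IH) => // K idK JK JltK; apply: contrapT => nQK.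
  by apply: nK; exists (exist _ K (conj idK nQK)).
have [f [_ fR]] := dependent_choice step (exist _ I (conj idI nQI)).
have f_ideal n : is_ideal (sval (f n)) by case: (f n) => ? [].
have f_mono m n x : (m <= n)%N -> sval (f m) x -> sval (f n) x.
  move/subnKC <-; elim: (n - m)%N => [|k IHk]; first by rewrite addn0.
  by move=> /IHk; rewrite addnS; have [+ _] := fR (m + k)%N; apply.
pose U x := exists n, sval (f n) x.
have idU : is_ideal U.
  split; first by exists 0%N; apply: ideal0 (f_ideal _).
    move=> x y [m fx] [n fy]; exists (maxn m n).
    apply: (idealD (f_ideal _)); first by apply: f_mono fx; rewrite leq_maxl.
    by apply: f_mono fy; rewrite leq_maxr.
  by move=> a x [n fx]; exists n; apply: (idealMl (f_ideal n)).
have [l Ul] := noethA U idU.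
have [n fn] : exists n, forall x, x \in l -> sval (f n) x.
  have : forall x, x \in l -> U x by move=> x lx; apply/Ul/mem_span.
  elim: (l) => [|g l' IHl] lU; first by exists 0%N.
  have [m fm] : U g by apply: lU; rewrite mem_head.
  have [n fn] : exists n, forall x, x \in l' -> sval (f n) x.
    by apply: IHl => x lx; apply: lU; rewrite inE lx orbT.
  exists (maxn m n) => x; rewrite inE => /predU1P[->|lx].
    by apply: f_mono fm; rewrite leq_maxl.
  by apply: f_mono (fn _ lx); rewrite leq_maxr.
have [_ [x fx nfx]] := fR n.
by apply: nfx; apply: span_min fn _ => //; apply/Ul; exists n.+1.
Qed.

End Ideals.

(** Every ideal of the integers is generated by its least positive element,
    which Euclidean division singles out. *)
Lemma noetherian_int : noetherian int.
Proof.
move=> I idI.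
have I_abs (z : int) : I z -> I (absz z)%:Z.
  by move=> Iz; have [->|->] : (absz z = z :> int) \/ (absz z = - z :> int);
    [lia | | apply: idealN].
have [[n0 [n0_gt0 In0]]|noI] :=
    pselect (exists n : nat, (0 < n)%N /\ I n%:Z); last first.
  exists [::] => z; split=> /= [Iz|->]; last exact: ideal0 idI.
  apply/eqP; rewrite -absz_eq0; apply/negPn/negP; rewrite -lt0n => z_gt0.
  by apply: noI; exists (absz z); split=> //; apply: I_abs.
have exI : exists n : nat, `[< (0 < n)%N /\ I n%:Z >].
  by exists n0; apply/asboolP.
case: (ex_minnP exI) => m /asboolP[m_gt0 Im] m_min.
exists [:: m%:Z] => z; split=> [Iz|[r /= /eqP]]; last first.
  by rewrite subr_eq0 => /eqP->; apply: idealMl idI _ _ Im.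
exists (z %/ m)%Z; set r := z - _ * _; apply/eqP/negPn/negP => r_neq0.
have Ir : I r by apply: idealB => //; apply: idealMl idI _ _ Im.
have := m_min (absz r); rewrite asboolT => [/(_ isT)|]; last first.
  by split; [rewrite lt0n absz_eq0 | apply: I_abs].
have m_neq0 : m%:Z != 0 by lia.
have := modz_ge0 z m_neq0; have := ltz_pmod z (_ : (0 < m%:Z)%R).
by rewrite /modz -/r; lia.
Qed.

Section HilbertBasis.
Context (R : comNzRingType).
Implicit Types (f g h : {poly R}) (I : {poly R} -> Prop).

Definition top_coefs I n (c : R) : Prop :=
  exists f, [/\ I f, (size f <= n.+1)%N & f`_n = c].

Lemma top_coefs_ideal I n : is_ideal I -> is_ideal (top_coefs I n).
Proof.
move=> idI; split.
- by exists 0; rewrite size_poly0 coef0; split=> //; apply: ideal0 idI.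
- move=> x y [f [If sf <-]] [g [Ig sg <-]]; exists (f + g).
  rewrite coefD; split=> //; first exact: idealD.
  by rewrite (leq_trans (size_polyD _ _)) // geq_max sf.
- move=> a x [f [If sf <-]]; exists (a%:P * f); rewrite coefCM.
  split=> //; first exact: idealMl idI _ _ If.
  by rewrite mul_polyC (leq_trans (size_scale_leq _ _)).
Qed.

Lemma top_coefs_shift I n k c :
  is_ideal I -> top_coefs I n c -> top_coefs I (n + k) c.
Proof.
move=> idI [f [If sf <-]]; exists ('X^k * f); split.
- exact: idealMl idI _ _ If.
- by rewrite (leq_trans (size_polyMleq _ _)) // size_polyXn; lia.
- by rewrite coefXnM addnK; case: ltnP => //; lia.
Qed.

Lemma lift_top_coefs I n (l : seq R) : (forall c, c \in l -> top_coefs I n c) ->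
  exists2 G : seq {poly R}, l = [seq g`_n | g <- G] &
    forall g, g \in G -> I g /\ (size g <= n.+1)%N.
Proof.
elim: l => [|c l IHl] cl; first by exists [::].
have [f [If sf fn]] : top_coefs I n c by apply: cl; rewrite mem_head.
have [G -> GP] : exists2 G : seq {poly R}, l = [seq g`_n | g <- G] &
    forall g, g \in G -> I g /\ (size g <= n.+1)%N.
  by apply: IHl => x lx; apply: cl; rewrite inE lx orbT.
exists (f :: G); first by rewrite /= fn.
by move=> g; rewrite inE => /predU1P[->|/GP].
Qed.

Lemma span_lift_top_coefs n (G : seq {poly R}) c :
  (forall g, g \in G -> (size g <= n.+1)%N) -> span [seq g`_n | g <- G] c ->
  exists h, [/\ span G h, (size h <= n.+1)%N & h`_n = c].
Proof.
elim: G c => [|g G IHG] c sG /=.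
  by move=> ->; exists 0; rewrite size_poly0 coef0.
have sg := sG g (mem_head _ _).
case=> r /IHG[|h [Gh sh hn]]; first by move=> y Gy; apply: sG; rewrite inE Gy orbT.
exists (h + r%:P * g); split.
- by exists r%:P; rewrite addrK.
- rewrite (leq_trans (size_polyD _ _)) // geq_max sh mul_polyC.
  by rewrite (leq_trans (size_scale_leq _ _)).
- by rewrite coefD coefCM hn subrK.
Qed.

(** Hilbert's basis theorem. The ideals [top_coefs I n] increase with [n], and
    their union is finitely generated, so they are constant from some [d] on.
    Polynomials of [I] of degree at most [d] whose coefficients of index
    [n <= d] generate [top_coefs I n] allow one to lower the degree of any
    element of [I]. *)
Theorem noetherian_poly : noetherian R -> noetherian {poly R}.
Proof.
move=> noethR I idI.
pose L c := exists n, top_coefs I n c.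
have L_mono m n c : (m <= n)%N -> top_coefs I m c -> top_coefs I n c.
  by move=> /subnKC <-; apply: top_coefs_shift.
have idL : is_ideal L.
  split; first by exists 0%N; apply: ideal0 (top_coefs_ideal _ idI).
    move=> x y [m Lx] [n Ly]; exists (maxn m n).
    apply: (idealD (top_coefs_ideal _ idI)).
      by apply: L_mono Lx; rewrite leq_maxl.
    by apply: L_mono Ly; rewrite leq_maxr.
  by move=> a x [n Lx]; exists n; apply: (idealMl (top_coefs_ideal _ idI)).
have [l Ll] := noethR L idL.
have [d Ld] : exists d, forall c, L c -> top_coefs I d c.
  suff [d ld] : exists d, forall c, c \in l -> top_coefs I d c.
    by exists d => c /Ll; apply: span_min => //; apply: top_coefs_ideal.
  have : forall c, c \in l -> L c by move=> c lc; apply/Ll/mem_span.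
  elim: (l) => [|c l' IHl] lL; first by exists 0%N.
  have [m Lm] : L c by apply: lL; rewrite mem_head.
  have [n Ln] : exists n, forall x, x \in l' -> top_coefs I n x.
    by apply: IHl => x lx; apply: lL; rewrite inE lx orbT.
  exists (maxn m n) => x; rewrite inE => /predU1P[->|lx].
    by apply: L_mono Lm; rewrite leq_maxl.
  by apply: L_mono (Ln _ lx); rewrite leq_maxr.
have exG n : exists G : seq {poly R},
    (forall g, g \in G -> I g /\ (size g <= n.+1)%N) /\
    (forall c, top_coefs I n c -> span [seq g`_n | g <- G] c).
  have [ln Lln] := noethR _ (top_coefs_ideal n idI).
  have [|G lnE GP] := @lift_top_coefs I n ln.
    by move=> c lc; apply/Lln/mem_span.
  by exists G; split=> // c /Lln; rewrite lnE.
have [G GP] := choice exG.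
exists (flatten [seq G n | n <- iota 0 d.+1]) => f; split; last first.
  apply: span_min => // g /flattenP[s /mapP[n _ ->]].
  by case: (GP n) => + _ => /[apply] -[].
elim: (size f) {-2}f (leqnn (size f)) => [|n IHn] {}f sf If.
  by move: sf; rewrite leqn0 size_poly_eq0 => /eqP->; apply: ideal0 (span_ideal _).
pose m := minn n d.
have Lfn : top_coefs I m f`_n.
  rewrite /m /minn; case: ifP => _; first by exists f.
  by apply: Ld; exists n, f.
have [Gm spanGm] := GP m.
have [|h [Gh sh hm]] := span_lift_top_coefs _ (spanGm _ Lfn).
  by move=> g /Gm[].
have Ih : I h by apply: span_min Gh => // g /Gm[].
have Xh : (size ('X^(n - m) * h)%R <= n.+1)%N.
  by rewrite (leq_trans (size_polyMleq _ _)) // size_polyXn; rewrite /m in sh *; lia.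
apply: (@idealBl _ _ _ ('X^(n - m) * h) (span_ideal _)).
  apply: (idealMl (span_ideal _)); apply: span_min Gh; first exact: span_ideal.
  move=> g Gg; apply: mem_span; apply/flattenP; exists (G m) => //.
  by apply: map_f; rewrite mem_iota /m; lia.
apply: IHn; last by apply: idealB => //; apply: idealMl idI _ _ Ih.
apply/leq_sizeP => j; rewrite leq_eqVlt => /predU1P[<-|nj].
  rewrite coefB coefXnM ifF; last by rewrite /m; lia.
  by rewrite (_ : n - (n - m) = m)%N ?hm ?subrr //; rewrite /m; lia.
by rewrite coefB !nth_default ?subrr //; apply: leq_trans nj.
Qed.

End HilbertBasis.

(** * Specializing to algebraically closed fields of positive characteristic *)

Record is_prime_ideal (A : comPzRingType) (P : A -> Prop) : Prop := {
  prime_ideal : is_ideal P;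
  prime_proper : ~ P 1;
  prime_mul : forall x y, P (x * y) -> P x \/ P y
}.

Lemma prime_exp (A : comPzRingType) (P : A -> Prop) x n :
  is_prime_ideal P -> P (x ^+ n) -> P x.
Proof.
move=> [idP nP1 PM]; elim: n => [|n IHn]; first by rewrite expr0 => /nP1.
by rewrite exprS => /PM[].
Qed.

(** The spectrum of [R] has points in almost every positive characteristic:
    an irreducible closed subset dominating the spectrum of [int] has, for each
    [p] prime to some [N], a point over any algebraically closed field of
    characteristic [p], outside a given proper closed subset. The element [x]
    makes the property inductive: it keeps the leading coefficients of
    algebraic relations from vanishing. *)
Definition specializable (R : comNzRingType) : Prop :=
  forall P : R -> Prop, is_prime_ideal P ->
  (forall n, (0 < n)%N -> ~ P n%:R) ->
  forall x, ~ P x ->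
  exists2 N, (0 < N)%N & forall p, prime p -> ~~ (p %| N)%N ->
  forall K : closedFieldType, p \in [pchar K] ->
  exists2 phi : {rmorphism R -> K}, forall y, P y -> phi y = 0 & phi x != 0.

Lemma specializable_int : specializable int.
Proof.
move=> P primeP Pchar0 x nPx; have idP := prime_ideal primeP.
exists (absz x) => [|p p_pr px K charK].
  rewrite lt0n absz_eq0; apply: contra_notN nPx => /eqP->; exact: ideal0 idP.
exists (intr : {rmorphism int -> K}) => [y Py|]; last first.
  by rewrite -(dvdz_pcharf charK).
have [->|y_neq0] := eqVneq y 0; first by rewrite rmorph0.
case: (Pchar0 (absz y)); first by rewrite lt0n absz_eq0.
have [->|->] : (absz y)%:R = y \/ (absz y)%:R = - y :> int by lia.
  by [].
exact: idealN.
Qed.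

Section SpecializePoly.
Context (R : idomainType) (P : {poly R} -> Prop).
Hypothesis primeP : is_prime_ideal P.
Let idP := prime_ideal primeP.

Let P0 (c : R) : Prop := P c%:P.

Let primeP0 : is_prime_ideal P0.
Proof.
split; rewrite /P0; last first.
- by move=> x y; rewrite polyCM => /(prime_mul primeP).
- exact: prime_proper primeP.
split; first exact: ideal0 idP.
- by move=> x y Px Py; rewrite polyCD; apply: idealD.
- by move=> a x Px; rewrite polyCM; apply: idealMl idP _ _ Px.
Qed.
Let idP0 := prime_ideal primeP0.

(** [small] is the ideal of [{poly R}] extended from [P0]: the polynomials
    that vanish over the domain [R / P0]. *)
Let small (f : {poly R}) : Prop := forall i, P0 f`_i.

Let ideal_small : is_ideal small.
Proof.
split=> [i|f g Pf Pg i|a f Pf i]; rewrite ?coef0 ?coefD ?coefM.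
- exact: ideal0 idP0.
- by apply: idealD (idP0) _ _ _ _.
- apply: big_ind => [|x y|j _]; [exact: ideal0 idP0|exact: idealD idP0 _ _|].
  exact: idealMl idP0 _ _ (Pf _).
Qed.

Let small_P f : small f -> P f.
Proof.
move=> Pf; rewrite -[f]coefK poly_def.
apply: big_ind => [|x y|j _]; [exact: ideal0 idP|exact: idealD idP _ _|].
by rewrite -mul_polyC; apply: idealMr idP (Pf _).
Qed.

Let P_polyC_small (c : R) n : P0 c -> small (c *: 'X^n).
Proof. by move=> Pc i; rewrite coefZ; apply: idealMr idP0 Pc. Qed.

(** An element of least degree among those which are not [small]: over
    the fraction field of [R / P0] it generates the extension of [J]. *)
Let least_elt (J : {poly R} -> Prop) :
  is_ideal J -> (forall f, P f -> J f) -> (exists2 f, J f & ~ small f) ->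
  exists h, [/\ J h, ~ P0 (lead_coef h) &
                forall f, J f -> (size f < size h)%N -> small f].
Proof.
move=> idJ PJ [f0 Jf0 nf0].
pose Q n := `[< exists f, [/\ J f, ~ small f & size f = n] >].
have exQ : exists n, Q n by exists (size f0); apply/asboolP; exists f0.
case: (ex_minnP exQ) => n /asboolP[h [Jh nh sh]] minh.
have lt_small f : J f -> (size f < size h)%N -> small f.
  move=> Jf; rewrite ltnNge => sf; apply: contrapT => nf; move/negP: sf; apply.
  by rewrite sh; apply: minh; apply/asboolP; exists f.
exists h; split=> // lead_h; apply: (nh).
set m := lead_coef h *: 'X^((size h).-1).
have small_m : small m by apply: P_polyC_small.
apply: (idealBl ideal_small small_m); apply: lt_small.
  by apply: idealB => //; apply/PJ/small_P.
have h_gt0 : (0 < size h)%N.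
  rewrite lt0n size_poly_eq0; apply/eqP => h0; apply: nh; rewrite h0.
  exact: ideal0 ideal_small.
rewrite -(prednK h_gt0) ltnS; apply/leq_sizeP => j.
rewrite leq_eqVlt => /predU1P[<-|hj].
  by rewrite coefB coefZ coefXn eqxx mulr1 subrr.
rewrite coefB coefZ coefXn gtn_eqF // mulr0 subr0 nth_default //.
by rewrite -(prednK h_gt0).
Qed.

Let pseudo_div (J : {poly R} -> Prop) h f :
  is_ideal J -> J h -> ~ P0 (lead_coef h) ->
  (forall f, J f -> (size f < size h)%N -> small f) -> J f ->
  exists k q r, [/\ lead_coef h ^+ k *: f = q * h + r, small r &
                    (size r < size h)%N].
Proof.
move=> idJ Jh nlead lt_small Jf.
exists (scalp f h), (f %/ h), (f %% h).
have sz : (size (f %% h)%R < size h)%N.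
  rewrite ltn_modp -lead_coef_eq0; apply: contra_notN nlead => /eqP->.
  exact: ideal0 idP0.
split=> //; first exact: Pdiv.Idomain.divp_eq.
apply: lt_small => //.
have -> : f %% h = lead_coef h ^+ scalp f h *: f - f %/ h * h.
  by rewrite Pdiv.Idomain.divp_eq addrAC subrr add0r.
apply: idealB => //; last exact: idealMl idJ _ _ Jh.
by rewrite -mul_polyC; apply: idealMl idJ _ _ Jf.
Qed.

Let P_scale c f : P (c *: f) -> P0 c \/ P f.
Proof. by rewrite -mul_polyC => /(prime_mul primeP). Qed.

(** If [P] is not extended from [P0] then the residue class of ['X] is
    algebraic over that of [R], so a nonzero [g] modulo [P] divides a nonzero
    constant: an element [h] of least degree of the ideal [P + (g)] divides
    [m] up to scalars, but it does not divide [m] properly because the degree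
    of [m] is least, and it is not in [P] because it divides [g]. *)
Let divides_constant m g :
  P m -> ~ P0 (lead_coef m) ->
  (forall f, P f -> (size f < size m)%N -> small f) -> ~ P g ->
  exists c v, ~ P0 c /\ P (c%:P - v * g).
Proof.
move=> Pm nlm minm nPg.
pose J f := exists v, P (f - v * g).
have PJ f : P f -> J f by exists 0; rewrite mul0r subr0.
have idJ : is_ideal J.
  split; first by apply: PJ; exact: ideal0 idP.
    move=> x y [v Px] [w Py]; exists (v + w).
    by rewrite mulrDl opprD addrACA; apply: (idealD idP).
  move=> a x [v Px]; exists (a * v).
  by rewrite -mulrA -mulrBr; apply: (idealMl idP).
have Jg : J g by exists 1; rewrite mul1r subrr; apply: ideal0 idP.
have [|h [Jh nlh minh]] := least_elt idJ PJ.
  by exists m; [exact: PJ | move=> /(_ (size m).-1)].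
suff sh : (size h <= 1)%N.
  have [v Phv] := Jh; exists h`_0, v; split; last by rewrite -size1_polyC.
  by move: nlh; rewrite {1}[h]size1_polyC // lead_coefC.
(* From [lead_coef h ^+ k *: m = q * h] modulo [small], either [h] or [q] is in
   [P]; the first forces [g] into [P], the second contradicts [minm]. *)
rewrite leqNgt; apply/negP => sh.
have h_neq0 : h != 0 by rewrite -size_poly_gt0; apply: leq_trans sh.
have nexp k : ~ P0 (lead_coef h ^+ k) by move=> /(prime_exp primeP0).
have [k [q [r [eqm small_r sr]]]] := pseudo_div idJ Jh nlh minh (PJ _ Pm).
have : P (q * h).
  have -> : q * h = lead_coef h ^+ k *: m - r by rewrite eqm addrK.
  apply: idealB => //; last exact: small_P.
  by rewrite -mul_polyC; apply: idealMl idP _ _ Pm.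
case/(prime_mul primeP) => [Pq|Ph]; last first.
  have [k' [q' [r' [eqg small_r' _]]]] := pseudo_div idJ Jh nlh minh Jg.
  have : P (lead_coef h ^+ k' *: g).
    rewrite eqg; apply: (idealD idP); last exact: small_P.
    exact: idealMl idP _ _ Ph.
  by case/P_scale => // /nexp.
have small_m : small (lead_coef h ^+ k *: m).
  rewrite eqm; apply: (idealD ideal_small) => //.
  rewrite mulrC; apply: (idealMl ideal_small).
  have [->|q_neq0] := eqVneq q 0; first exact: ideal0 ideal_small.
  apply: minm => //.
  have shm : (size h <= size m)%N.
    rewrite leqNgt; apply/negP => /(minh _ (PJ _ Pm))/(_ (size m).-1).
    exact: nlm.
  have : (size (q * h)%R <= size m)%N.
    have -> : q * h = lead_coef h ^+ k *: m - r by rewrite eqm addrK.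
    rewrite (leq_trans (size_polyD _ _)) // geq_max size_scale_leq size_polyN.
    by rewrite (leq_trans (ltnW sr)).
  by rewrite size_mul //; lia.
have := small_m (size m).-1; rewrite coefZ => /(prime_mul primeP0)[/nexp//|].
exact: nlm.
Qed.

(** The class of ['X] modulo [P] is either transcendental over [R / P0], and
    then it may be sent to any point of [K] that is not a root of [g], or
    algebraic with an equation [m] of least degree, and then it may be sent to
    any root of [m], as soon as the leading coefficient of [m] does not vanish
    and the nonzero constant divided by [g] does not either. *)
Lemma specialize_poly : specializable R ->
  (forall n, (0 < n)%N -> ~ P n%:R) -> forall g, ~ P g ->
  exists2 N, (0 < N)%N & forall p, prime p -> ~~ (p %| N)%N ->
  forall K : closedFieldType, p \in [pchar K] ->
  exists2 phi : {rmorphism {poly R} -> K}, forall y, P y -> phi y = 0 &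
    phi g != 0.
Proof.
move=> specR charP g nPg.
have charP0 n : (0 < n)%N -> ~ P0 n%:R.
  by rewrite /P0 polyC_natr; apply: charP.
have small_ker (K : nzRingType) (phi : {rmorphism R -> K}) f :
    (forall c, P0 c -> phi c = 0) -> small f -> map_poly phi f = 0.
  by move=> phi0 sf; apply/polyP => i; rewrite coef_map coef0 /= phi0.
have [[m0 Pm0 nm0]|noP] := pselect (exists2 f, P f & ~ small f).
  have [|m [Pm nlm minm]] := least_elt idP (fun f Pf => Pf); first by exists m0.
  have [c [v [nPc Pcv]]] := divides_constant Pm nlm minm nPg.
  have nPcm : ~ P0 (c * lead_coef m) by move=> /(prime_mul primeP0)[].
  have [N N_gt0 NP] := specR _ primeP0 charP0 _ nPcm.
  exists N => // p p_pr pN K charK.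
  have [phi phi0] := NP p p_pr pN K charK.
  rewrite rmorphM mulf_eq0 negb_or => /andP[phic phim].
  have /closed_rootP[w /rootP mw0] : size (map_poly phi m) != 1%N.
    rewrite size_map_poly_id0 //; apply/eqP => sm; apply: nlm.
    by rewrite lead_coefE sm /P0 -size1_polyC // sm.
  have com : commr_rmorph phi w by move=> x; apply: mulrC.
  have evalP f : P f -> (map_poly phi f).[w] = 0.
    move=> Pf; have [k [q [r [eqf small_r _]]]] := pseudo_div idP Pm nlm minm Pf.
    have : (map_poly phi (lead_coef m ^+ k *: f)).[w] = 0.
      rewrite eqf rmorphD rmorphM /= hornerD hornerM mw0 mulr0 add0r.
      by rewrite small_ker ?horner0.
    rewrite map_polyZ hornerZ rmorphXn /= => /eqP.
    by rewrite mulf_eq0 expf_eq0 (negPf phim) andbF /= => /eqP.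
  exists (horner_morph com) => [f /evalP //|].
  apply: contraNneq phic => /= gw0.
  have := evalP _ Pcv; rewrite rmorphB rmorphM /= hornerD hornerN hornerM.
  by rewrite [X in _ * X]gw0 mulr0 subr0 map_polyC hornerC => ->.
have Psmall f : P f -> small f.
  by move=> Pf; apply: contrapT => nf; apply: noP; exists f.
have [i ngi] : exists i, ~ P0 g`_i.
  by apply/existsNP => sg; apply: nPg; apply: small_P.
have [N N_gt0 NP] := specR _ primeP0 charP0 _ ngi.
exists N => // p p_pr pN K charK.
have [phi phi0 phig] := NP p p_pr pN K charK.
have /closed_nonrootP[w gw] : map_poly phi g != 0.
  by apply: contraNneq phig => g0; rewrite -coef_map g0 coef0.
have com : commr_rmorph phi w by move=> x; apply: mulrC.
exists (horner_morph com) => // f Pf.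
suff : (map_poly phi f).[w] = 0 by [].
by rewrite (small_ker _ phi f) ?horner0 //; apply: Psmall.
Qed.

End SpecializePoly.

Lemma specializable_poly (R : idomainType) :
  specializable R -> specializable {poly R}.
Proof. by move=> specR P primeP charP g nPg; apply: specialize_poly. Qed.

(** * Nullstellensatz over the integers *)

Lemma pigeonhole (T : finType) (f : nat -> T) :
  exists i k, f i = f (i + k.+1)%N.
Proof.
pose g (i : 'I_#|T|.+1) := f i.
have /injectivePn[i [j ij gij]] : ~~ injectiveb g.
  by apply/negP => /injectiveP/leq_card; rewrite card_ord ltnn.
wlog lt_ij : i j ij gij / (i < j)%N => [IH|].
  case: (ltngtP i j) ij => [lt_ij|lt_ji|/val_inj->] ij; first exact: IH gij _.
    by apply: IH (esym gij) lt_ji; rewrite eq_sym.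
  by rewrite eqxx in ij.
by exists i, (j - i).-1; rewrite prednK ?subn_gt0 // subnKC // ltnW.
Qed.

Lemma exprB_pchar (K : comNzRingType) p n (x y : K) : p \in [pchar K] ->
  (x - y) ^+ (p ^ n) = x ^+ (p ^ n) - y ^+ (p ^ n).
Proof.
move=> charK; apply: (addIr (y ^+ (p ^ n))); rewrite subrK -exprDn_pchar ?subrK //.
by rewrite pnatX (pnatE _ (pcharf_prime charK)) charK.
Qed.

(** The elements of an algebraic closure of the prime field are roots of
    polynomials over it, so their powers take finitely many values. Hence two
    of the [x ^+ (p ^ i)] coincide, and the injectivity of the Frobenius map
    cancels the smaller exponent. *)
Lemma exists_closed_field_pchar p : prime p ->
  exists2 K : closedFieldType, p \in [pchar K] &
    forall x : K, exists2 k, (0 < k)%N & x ^+ (p ^ k) = x.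
Proof.
move=> p_pr; have [K [iota intK]] := countable_algebraic_closure 'F_p.
have charK : p \in [pchar K] by rewrite (fmorph_pchar iota) pchar_Fp.
exists K => // x; have [q q_mon /rootP qx] := intK x.
pose f i : 'rV['F_p]_(size q) := \row_j ('X^(p ^ i) %% q)`_j.
have [i [k fik]] := pigeonhole f; exists k.+1 => //.
have powE n : x ^+ n = (map_poly iota ('X^n %% q)).[x].
  have := congr1 (fun h => (map_poly iota h).[x]) (divp_eq 'X^n q).
  by rewrite rmorphD rmorphM /= hornerD hornerM qx mulr0 add0r map_polyXn hornerXn.
have {fik} pow_eq : x ^+ (p ^ i) = x ^+ (p ^ (i + k.+1)).
  rewrite !powE; congr (map_poly _ _).[_]; apply/polyP => j.
  have q_neq0 : q != 0 by apply: monic_neq0.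
  have [jq|qj] := ltnP j (size q).
    by have /rowP/(_ (Ordinal jq)) := fik; rewrite !mxE.
  by rewrite !nth_default //; apply: leq_trans qj; rewrite ltnW // ltn_modp.
have frob_inj n (y z : K) : y ^+ (p ^ n) = z ^+ (p ^ n) -> y = z.
  move=> /eqP; rewrite -subr_eq0 -(exprB_pchar _ _ _ charK).
  by rewrite expf_eq0 subr_eq0 => /andP[_ /eqP].
by apply: (frob_inj i); rewrite pow_eq addnC expnD exprM.
Qed.

Definition subring_gen (A : comPzRingType) (s : seq A) (x : A) : Prop :=
  forall B : {pred A}, subring_closed B -> {subset s <= B} -> x \in B.

Definition generates (A : comPzRingType) (s : seq A) : Prop :=
  forall x, subring_gen s x.

Lemma subring_gen_ind (A : comPzRingType) (s : seq A) (Q : A -> Prop) :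
  Q 1 -> (forall x y, Q x -> Q y -> Q (x - y)) ->
  (forall x y, Q x -> Q y -> Q (x * y)) -> (forall x, x \in s -> Q x) ->
  forall x, subring_gen s x -> Q x.
Proof.
move=> Q1 QB QM Qs x gen_x; apply/asboolP.
apply: (gen_x [pred x | `[< Q x >]]); last by move=> y /Qs ?; apply/asboolP.
split=> [|y z /asboolP Qy /asboolP Qz|y z /asboolP Qy /asboolP Qz]; apply/asboolP.
- exact: Q1.
- exact: QB.
- exact: QM.
Qed.

Lemma generates_ind (A : comPzRingType) (s : seq A) (Q : A -> Prop) :
  generates s -> Q 1 -> (forall x y, Q x -> Q y -> Q (x - y)) ->
  (forall x y, Q x -> Q y -> Q (x * y)) -> (forall x, x \in s -> Q x) ->
  forall x, Q x.
Proof. by move=> gen_s Q1 QB QM Qs x; apply: subring_gen_ind (gen_s x). Qed.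

(** Finite index of an additive subgroup, given by a map to a finite type
    which separates its cosets. *)
Definition cofinite (A : zmodType) (I : A -> Prop) : Prop :=
  exists (T : finType) (f : A -> T), forall x y, f x = f y -> I (x - y).

Lemma cofiniteI (A : zmodType) (I J : A -> Prop) :
  cofinite I -> cofinite J -> cofinite (fun x => I x /\ J x).
Proof.
move=> [T [f fI]] [U [g gJ]]; exists (T * U)%type, (fun x => (f x, g x)).
by move=> x y [/fI Ix /gJ Jx].
Qed.

(** A finitely generated subring of [K] consists of roots of
    ['X^(p ^ k) - 'X] for some [k], hence is finite. *)
Lemma cofinite_ker (A : comPzRingType) (s : seq A) p (K : closedFieldType)
    (chi : A -> K) : generates s -> p \in [pchar K] ->
  (forall x : K, exists2 k, (0 < k)%N & x ^+ (p ^ k) = x) ->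
  zmod_morphism chi -> monoid_morphism chi -> cofinite (fun x => chi x = 0).
Proof.
move=> gen_s charK frobK chiB [chi1 chiM].
have p_pr := pcharf_prime charK.
have [k k_gt0 ks] : exists2 k, (0 < k)%N &
    forall x, x \in s -> chi x ^+ (p ^ k) = chi x.
  elim: (s) => [|y s' [k k_gt0 ks]]; first by exists 1%N.
  have [j j_gt0 jy] := frobK (chi y).
  have frobM z i n : z ^+ (p ^ i) = z -> z ^+ (p ^ (i * n)) = z.
    move=> zi; elim: n => [|n IHn]; first by rewrite muln0 expr1.
    by rewrite mulnS expnD exprM zi.
  exists (j * k)%N; first by rewrite muln_gt0 j_gt0.
  move=> x; rewrite inE => /predU1P[->|/ks xk]; first exact: frobM.
  by rewrite mulnC; apply: frobM.
have kA x : chi x ^+ (p ^ k) = chi x.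
  move: x; apply: (generates_ind gen_s) => [|x y xk yk|x y xk yk|] //.
  - by rewrite chi1 expr1n.
  - by rewrite chiB (exprB_pchar _ _ _ charK) xk yk.
  - by rewrite chiM exprMn xk yk.
have q_gt1 : (1 < p ^ k)%N by rewrite -(expn0 p) ltn_exp2l ?prime_gt1.
pose q : {poly K} := 'X^(p ^ k) - 'X.
have q_neq0 : q != 0.
  rewrite -lead_coef_eq0 lead_coefDl ?lead_coefXn ?oner_neq0 //.
  by rewrite size_polyN size_polyX size_polyXn.
have [rs qE] := closed_field_poly_normal q.
have chi_rs x : chi x \in rs.
  rewrite -root_prod_XsubC -(rootZ _ _ (_ : lead_coef q != 0)) ?lead_coef_eq0 //.
  by rewrite -qE /root !hornerE kA subrr.
exists 'I_(size rs).+1, (fun x => inord (index (chi x) rs)) => x y.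
move/(congr1 val); rewrite /= !inordK ?ltnS ?index_size // => idx.
by apply/eqP; rewrite chiB subr_eq0 -(nth_index 0 (chi_rs x)) idx nth_index.
Qed.

Lemma noetherian_surj (R A : comPzRingType) (psi : {rmorphism R -> A}) :
  (forall x, exists y, psi y = x) -> noetherian R -> noetherian A.
Proof.
move=> surj noethR I idI.
have idJ : is_ideal (fun y => I (psi y)).
  split=> [|x y Ix Iy|a x Ix]; rewrite ?rmorph0 ?rmorphD ?rmorphM.
  - exact: ideal0 idI.
  - exact: idealD.
  - exact: idealMl idI _ _ Ix.
have [l Il] := noethR _ idJ.
exists (map psi l) => x; split; last first.
  by apply: span_min => // _ /mapP[y ly ->]; apply/Il/mem_span.
have [y <-] := surj x => /Il; elim: (l) y => [|g l' IHl] y /=.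
  by move=> ->; rewrite rmorph0.
by case=> r /IHl; rewrite rmorphB rmorphM; exists (psi r).
Qed.

(** A finitely generated ring is a quotient of some [{poly ... {poly int}}];
    these are built by iterating the passage from [R] to [{poly R}]. *)
Lemma presentation_nz (A : comNzRingType) (s : seq A) : generates s ->
  exists (R : idomainType) (psi : {rmorphism R -> A}),
    [/\ noetherian R, specializable R & forall x, exists y, psi y = x].
Proof.
move=> gen_s.
suff [R [psi [noethR specR psi_s]]] :
    exists (R : idomainType) (psi : {rmorphism R -> A}),
      [/\ noetherian R, specializable R & forall x, x \in s -> exists y, psi y = x].
  exists R, psi; split=> //; apply: (generates_ind gen_s) => //.
  - by exists 1; rewrite rmorph1.
  - by move=> _ _ [x <-] [y <-]; exists (x - y); rewrite rmorphB.
  - by move=> _ _ [x <-] [y <-]; exists (x * y); rewrite rmorphM.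
elim: (s) => [|a s' [R [psi [noethR specR psi_s]]]].
  exists int, (intr : {rmorphism int -> A}).
  by split; [exact: noetherian_int | exact: specializable_int|].
have com : commr_rmorph psi a by move=> x; apply: mulrC.
exists {poly R}, (horner_morph com); split.
- exact: noetherian_poly.
- exact: specializable_poly.
- move=> x; rewrite inE => /predU1P[->|/psi_s[y <-]].
    by exists 'X; rewrite /= horner_morphX.
  by exists y%:P; rewrite /= horner_morphC.
Qed.

(** Polynomial evaluation takes values in a nontrivial ring, so the nontrivial
    structure [B] on [A] is used to build the morphism. *)
Lemma presentation (A : comPzRingType) (s : seq A) : generates s -> (1 : A) != 0 ->
  exists (R : idomainType) (psi : {rmorphism R -> A}),
    [/\ noetherian R, specializable R & forall x, exists y, psi y = x].
Proof.
move=> gen_s A_nz.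
pose B : comNzRingType := HB.pack A (GRing.PzSemiRing_isNonZero.Build A A_nz).
have [R [psi [noethR specR surj]]] := @presentation_nz B s gen_s.
have psiB : zmod_morphism (psi : R -> A) by move=> x y; exact: rmorphB psi x y.
have psiM : monoid_morphism (psi : R -> A).
  by split=> [|x y]; [exact: rmorph1 psi | exact: rmorphM psi x y].
pose psiA : {rmorphism R -> A} := HB.pack (psi : R -> A)
  (GRing.isZmodMorphism.Build R A psi psiB)
  (GRing.isMonoidMorphism.Build R A psi psiM).
by exists R, psiA; split.
Qed.

Lemma noetherian_fg_ring (A : comPzRingType) (s : seq A) :
  generates s -> noetherian A.
Proof.
move=> gen_s; have [A0|A_nz] := eqVneq (1 : A) 0.
  move=> I idI; exists [::] => x.
  have -> : x = 0 by rewrite -[x]mulr1 A0 mulr0.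
  by split=> // _; apply: ideal0 idI.
have [R [psi [noethR _ surj]]] := presentation gen_s A_nz.
exact: noetherian_surj surj noethR.
Qed.

(** The last condition says that [M] is not comaximal with the annihilator of
    any element [d] of [A / I] of infinite additive order; it would follow from
    [M] containing that annihilator, but unlike this stronger condition it is
    stable under replacing [M] by the intersection with a second ideal. *)
Definition separating (A : comPzRingType) p (I M : A -> Prop) : Prop :=
  [/\ is_ideal M, cofinite M, M p%:R &
      forall d, (forall n, (0 < n)%N -> ~ I (d *+ n)) ->
      forall e, M e -> ~ I ((1 - e) * d)].

Section SeparatingIdeals.
Context (A : comPzRingType) (s : seq A).
Hypothesis gen_s : generates s.

(** The kernel of a point of [A / P] over an algebraic closure of the prime
    field is an ideal of finite index, since its values are algebraic. *)
Lemma prime_in_cofinite (P : A -> Prop) :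
  is_prime_ideal P -> (forall n, (0 < n)%N -> ~ P n%:R) ->
  exists2 N, (0 < N)%N & forall p, prime p -> ~~ (p %| N)%N ->
  exists M : A -> Prop,
    [/\ is_ideal M, cofinite M, M p%:R, ~ M 1 & forall x, P x -> M x].
Proof.
move=> primeP charP; have idP := prime_ideal primeP.
have A_nz : (1 : A) != 0.
  by apply: contra_notN (prime_proper primeP) => /eqP->; apply: ideal0 idP.
have [R [psi [_ specR surj]]] := presentation gen_s A_nz.
have primeP' : is_prime_ideal (fun y => P (psi y)).
  split; first split=> [|x y|a x]; rewrite ?rmorph0 ?rmorphD ?rmorphM ?rmorph1.
  - exact: ideal0 idP.
  - exact: idealD.
  - exact: idealMl.
  - exact: prime_proper primeP.
  - by move=> x y; rewrite rmorphM; apply: prime_mul.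
have charP' n : (0 < n)%N -> ~ P (psi n%:R) by rewrite rmorph_nat; apply: charP.
have nP1 : ~ P (psi 1) by rewrite rmorph1; apply: prime_proper.
have [N N_gt0 NP] := specR _ primeP' charP' _ nP1.
exists N => // p p_pr pN.
have [K charK frobK] := exists_closed_field_pchar p_pr.
have [phi phi0 _] := NP p p_pr pN K charK.
have [sec secK] := choice surj.
pose chi x := phi (sec x).
have chiE y : chi (psi y) = phi y.
  apply/eqP; rewrite -subr_eq0 -rmorphB; apply/eqP/phi0.
  by rewrite rmorphB secK subrr; apply: ideal0 idP.
have chiB : zmod_morphism chi.
  by move=> x y; rewrite -[in LHS](secK x) -[in LHS](secK y) -rmorphB chiE rmorphB.
have chi1 : chi 1 = 1 by rewrite -(rmorph1 psi) chiE rmorph1.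
have chiM : {morph chi : x y / x * y}.
  by move=> x y; rewrite -[in LHS](secK x) -[in LHS](secK y) -rmorphM chiE rmorphM.
have chi0 : chi 0 = 0 by rewrite -(rmorph0 psi) chiE rmorph0.
exists (fun x => chi x = 0); split.
- split=> // [x y x0 y0|a x x0]; last by rewrite chiM x0 mulr0.
  by rewrite -[y]opprK -[- y]sub0r !chiB x0 y0 chi0 !subr0.
- exact: cofinite_ker gen_s charK frobK chiB (conj chi1 chiM).
- by rewrite -(rmorph_nat psi) chiE rmorph_nat (pcharf0 charK).
- by rewrite chi1; apply/eqP; rewrite oner_eq0.
- by move=> x Px; apply: phi0; rewrite secK.
Qed.

Let separable (I : A -> Prop) : Prop :=
  exists2 N, (0 < N)%N & forall p, prime p -> ~~ (p %| N)%N ->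
  exists M, separating p I M.

Let separable_torsion (I : A -> Prop) n :
  is_ideal I -> (0 < n)%N -> I n%:R -> separable I.
Proof.
move=> idI n_gt0 In; exists 1%N => // p _ _; exists (fun=> True); split=> //.
  by exists unit, (fun=> tt).
by move=> d /(_ n n_gt0)[]; rewrite -mulr_natr; apply: idealMl idI _ _ In.
Qed.

(** The module [A / I] being an extension of [A / (I + (x))] by
    [A / (I : x)], the ideal [M] for [A / I] is obtained by intersecting
    those of the two factors. *)
Let separable_split (I : A -> Prop) x : is_ideal I ->
  separable (fun z => exists r, I (z - r * x)) ->
  separable (fun z => I (z * x)) -> separable I.
Proof.
move=> idI [N1 N1_gt0 sep1] [N2 N2_gt0 sep2].
exists (N1 * N2)%N => [|p p_pr]; first by rewrite muln_gt0 N1_gt0.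
rewrite Euclid_dvdM // negb_or => /andP[/(sep1 p p_pr)[M1 [idM1 fM1 M1p M1P]]].
case/(sep2 p p_pr)=> M2 [idM2 fM2 M2p M2P].
exists (fun e => M1 e /\ M2 e); split=> //; last 1 first.
- move=> d nId e [M1e M2e] Ied.
  have [d_nt|] := pselect (forall n, (0 < n)%N -> ~ exists r, I (d *+ n - r * x)).
    by apply: (M1P d d_nt e M1e); exists 0; rewrite mul0r subr0.
  case/existsNP=> n /not_implyP[n_gt0 /contrapT[r Idr]].
  apply: (M2P r _ e M2e) => [m m_gt0 Irm|].
    apply: (nId (n * m)%N); first by rewrite muln_gt0 n_gt0.
    apply: (idealBl idI Irm); rewrite mulrnA mulrnAl -mulrnBl.
    by rewrite -mulr_natr; apply: idealMr idI Idr.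
  have -> : (1 - e) * r * x = ((1 - e) * d) *+ n - (1 - e) * (d *+ n - r * x).
    by rewrite mulrBr mulrnAr subKr mulrA.
  apply: idealB => //; last exact: idealMl idI _ _ Idr.
  by rewrite -mulr_natr; apply: idealMr idI Ied.
- exact: ideal_cap.
- exact: cofiniteI.
Qed.

(** Noetherian induction. When [I] is prime the annihilator of a nonzero
    element of [A / I] is [I] itself; otherwise some [x * y] in [I] provides
    the larger ideals [I + (x)] and [(I : x)]. This replaces the finiteness of
    the set of associated primes. *)
Lemma separable_ideal (I : A -> Prop) : is_ideal I -> separable I.
Proof.
move: I; apply: noetherian_ind; first exact: noetherian_fg_ring gen_s.
move=> I idI IH.
have [[n n_gt0 In]|char0] := pselect (exists2 n, (0 < n)%N & I n%:R).
  exact: separable_torsion idI n_gt0 In.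
have [primeI|nprime] := pselect (is_prime_ideal I).
  have [|N N_gt0 NP] := prime_in_cofinite primeI.
    by move=> n n_gt0 In; apply: char0; exists n.
  exists N => // p p_pr pN; have [M [idM fM Mp nM1 IM]] := NP p p_pr pN.
  exists M; split=> // d /(_ 1%N isT) nId e Me /(prime_mul primeI)[/IM Me1|//].
  by apply: nM1; rewrite -(subrK e 1); apply: idealD.
have [x [y [Ixy nIx nIy]]] : exists x y, [/\ I (x * y), ~ I x & ~ I y].
  apply: contrapT => nxy; apply: nprime; split=> //.
    by move=> I1; apply: char0; exists 1%N.
  move=> x y Ixy; apply: contrapT => /not_orP[nIx nIy].
  by apply: nxy; exists x, y.
apply: (separable_split (x := x) idI); apply: IH.
- split; first by exists 0; rewrite mul0r subr0; apply: ideal0 idI.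
    move=> z w [r Iz] [t Iw]; exists (r + t).
    by rewrite mulrDl opprD addrACA; apply: (idealD idI).
  move=> a z [r Iz]; exists (a * r).
  by rewrite -mulrA -mulrBr; apply: (idealMl idI).
- by move=> z Iz; exists 0; rewrite mul0r subr0.
- by exists x => //; exists 1; rewrite mul1r subrr; apply: ideal0 idI.
- split=> [|z w Iz Iw|a z Iz]; rewrite ?mul0r ?mulrDl -?mulrA.
  + exact: ideal0 idI.
  + exact: idealD.
  + exact: idealMl.
- by move=> z Iz; apply: idealMr.
- by exists y => //; rewrite mulrC.
Qed.

End SeparatingIdeals.

(** * Products of ideals *)

Section IdealProducts.
Context (A : comPzRingType).
Implicit Types (I J S : A -> Prop) (l : seq A).

(** The set [S] is only required to be closed under sums, not to be an ideal:
    membership in a product can then be propagated through maps that are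
    merely additive. *)
Definition idprod I J (x : A) : Prop :=
  forall S, S 0 -> (forall y z, S y -> S z -> S (y + z)) ->
    (forall a b, I a -> J b -> S (a * b)) -> S x.

Lemma idprod_mul I J a b : I a -> J b -> idprod I J (a * b).
Proof. by move=> Ia Jb S _ _; apply. Qed.

Lemma idprod_ind I J S x : S 0 -> (forall y z, S y -> S z -> S (y + z)) ->
  (forall a b, I a -> J b -> S (a * b)) -> idprod I J x -> S x.
Proof. by move=> S0 SD SM; apply. Qed.

Lemma idprod_ideal I J : is_ideal I -> is_ideal (idprod I J).
Proof.
move=> idI; split=> [S S0 //|x y IJx IJy S S0 SD SM|a x IJx].
  by apply: (SD); [apply: IJx | apply: IJy].
apply: (@idprod_ind I J (fun y => idprod I J (a * y))) IJx
  => [|y z IJy IJz|b c Ib Jc].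
- by move=> S S0 _ _; rewrite mulr0.
- by move=> S S0 SD SM; rewrite mulrDr; apply: (SD); [apply: IJy|apply: IJz].
- by rewrite mulrA; apply: idprod_mul => //; apply: idealMl idI _ _ Ib.
Qed.

Lemma idprod_subl I J x : is_ideal I -> idprod I J x -> I x.
Proof.
move=> idI; apply: idprod_ind; [exact: ideal0 idI | exact: idealD idI|].
by move=> a b Ia _; apply: idealMr idI Ia.
Qed.

Lemma idprod_subr I J x : is_ideal J -> idprod I J x -> J x.
Proof.
move=> idJ; apply: idprod_ind; [exact: ideal0 idJ | exact: idealD idJ|].
by move=> a b _; apply: idealMl idJ _ _.
Qed.

Lemma idprod_span_cons I g l x : is_ideal I -> idprod I (span (g :: l)) x ->
  exists2 i, I i & idprod I (span l) (x - i * g).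
Proof.
move=> idI; have idIl := idprod_ideal (span l) idI.
pose S y := exists2 i, I i & idprod I (span l) (y - i * g).
apply: (@idprod_ind _ _ S) => [|y z [i Ii ly] [j Ij lz]|a b Ia [r lb]].
- by exists 0; rewrite ?mul0r ?subr0; [exact: ideal0 idI | exact: ideal0 idIl].
- exists (i + j); first exact: idealD.
  by rewrite mulrDl opprD addrACA; apply: (idealD idIl).
- exists (a * r); first exact: idealMr.
  by rewrite -mulrA -mulrBr; apply: idprod_mul.
Qed.

(** Nakayama's lemma. The multiplier [u] makes an induction on the generators
    possible: the relation expressing [u * g] through [l] allows [g] to be
    eliminated from the relations expressing the [u * h] with [h] in [l]. *)
Lemma nakayama I l u : is_ideal I -> I (1 - u) ->
  (forall h, h \in l -> idprod I (span l) (u * h)) ->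
  exists2 e, I e & forall d, span l d -> (1 - e) * d = 0.
Proof.
move=> idI; elim: l u => [|g l IHl] u Iu ul.
  by exists 0 => [|d ->]; [exact: ideal0 idI | rewrite mulr0].
have idIl := idprod_ideal (span l) idI.
have [i Ii ug] := idprod_span_cons idI (ul g (mem_head _ _)).
pose w := u - i.
have wg : idprod I (span l) (w * g) by rewrite mulrBl.
have Iw : I (1 - w) by rewrite opprB addrCA addrC; apply: (idealD idI).
have [|h lh|e Ie el] := IHl (w * u).
- have -> : 1 - w * u = (1 - w) + w * (1 - u) by ring.
  by apply: idealD => //; apply: idealMl idI _ _ Iu.
- have [|j Ij uh] := idprod_span_cons idI (ul h _); first by rewrite inE lh orbT.
  have -> : w * u * h = w * (u * h - j * g) + j * (w * g) by ring.
  by apply: (idealD idIl); apply: (idealMl idIl).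
exists ((1 - w) + w * e) => [|d [r ld]].
  by apply: idealD => //; apply: idealMl idI _ _ Ie.
have -> : (1 - ((1 - w) + w * e)) * d =
          w * ((1 - e) * (d - r * g)) + r * ((1 - e) * (w * g)) by ring.
by rewrite !el ?mulr0 ?addr0 //; apply: idprod_subr wg; apply: span_ideal.
Qed.

(** If [I] is generated by [l] then [I / I ^ 2] is a quotient of
    [(A / I) ^ (size l)]. *)
Lemma cofinite_square I :
  noetherian A -> is_ideal I -> cofinite I -> cofinite (idprod I I).
Proof.
move=> noethA idI [T [f fI]]; have idII := idprod_ideal I idI.
have [l Il] := noethA I idI.
have [U [h hI]] : exists (U : finType) (h : A -> U), forall x y,
    span l x -> span l y -> h x = h y -> idprod I I (x - y).
  have : forall g, g \in l -> I g by move=> g lg; apply/Il/mem_span.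
  elim: (l) => [|g l' IHl] lI.
    exists unit, (fun=> tt) => x y -> -> _.
    by rewrite subrr; apply: ideal0 idII.
  have [|U [h hI]] := IHl; first by move=> y ly; apply: lI; rewrite inE ly orbT.
  have Ig : I g by apply: lI; rewrite mem_head.
  have exr x : exists r, span (g :: l') x -> span l' (x - r * g).
    by have [[r lr]|nl] := pselect (span (g :: l') x); [exists r | exists 0].
  have [r rP] := choice exr.
  exists (T * U)%type, (fun x => (f (r x), h (x - r x * g))) => x y lx ly.
  case=> /fI Ir /hI-/(_ (rP _ lx) (rP _ ly)) IIxy.
  have -> : x - y = (r x - r y) * g + (x - r x * g - (y - r y * g)) by ring.
  by apply: (idealD idII) => //; apply: idprod_mul.
have exrep t : exists x, (exists y, f y = t) -> f x = t.
  by have [[y fy]|nt] := pselect (exists y, f y = t); [exists y | exists 0].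
have [rep repP] := choice exrep.
have rep_l x : span l (x - rep (f x)).
  by apply/Il/fI; rewrite repP //; exists x.
exists (T * U)%type, (fun x => (f x, h (x - rep (f x)))) => x y [fxy hxy].
have -> : x - y = x - rep (f x) - (y - rep (f y)).
  by rewrite fxy opprB addrA subrK.
exact: hI.
Qed.

End IdealProducts.

(** * Automorphisms of prime order that are trivial modulo a square *)

Section TrivialModSquare.
Context (A : comPzRingType) (s : seq A) (M : A -> Prop) (sigma : A -> A).
Hypotheses (gen_s : generates s) (idM : is_ideal M).
Hypotheses (sigmaB : zmod_morphism sigma) (sigmaM : monoid_morphism sigma).
Hypothesis sigma_triv : forall x, idprod M M (sigma x - x).

Let delta x := sigma x - x.
Let l := map delta s.
Let D := span l.
Let idD : is_ideal D := span_ideal l.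
Let MD := idprod M D.
Let idMD : is_ideal MD := idprod_ideal D idM.

Let deltaB x y : delta (x - y) = delta x - delta y.
Proof. by rewrite /delta sigmaB; ring. Qed.

Let delta0 : delta 0 = 0.
Proof. by have := deltaB 0 0; rewrite !subrr. Qed.

Let deltaD x y : delta (x + y) = delta x + delta y.
Proof. by rewrite -{1}[y]opprK deltaB -[- y]sub0r deltaB delta0 sub0r opprK. Qed.

Let deltaMul x y : delta (x * y) = sigma y * delta x + x * delta y.
Proof. by rewrite /delta (sigmaM.2 x y); ring. Qed.

Let D_delta x : D (delta x).
Proof.
move: x; apply: (generates_ind gen_s) => [|x y Dx Dy|x y Dx Dy|x sx].
- by rewrite /delta sigmaM.1 subrr; apply: ideal0 idD.
- by rewrite deltaB; apply: idealB.
- by rewrite deltaMul; apply: (idealD idD); apply: (idealMl idD).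
- by apply: mem_span; apply: map_f.
Qed.

Let D_square x : D x -> idprod M M x.
Proof.
move=> Dx; apply: span_min Dx => [|_ /mapP[a _ ->]]; last exact: sigma_triv.
exact: idprod_ideal.
Qed.

Let D_M x : D x -> M x.
Proof. by move=> /D_square; apply: idprod_subl. Qed.

Let delta_square x : idprod M M x -> MD (delta x).
Proof.
apply: (@idprod_ind _ _ _ (fun y => MD (delta y))) => [|y z MDy MDz|a b Ma Mb].
- by rewrite delta0; apply: ideal0 idMD.
- by rewrite deltaD; apply: (idealD idMD).
rewrite deltaMul; apply: (idealD idMD); apply: idprod_mul => //.
by rewrite -(subrK b (sigma b)); apply: idealD => //; apply: D_M; apply: D_delta.
Qed.

(** As [D] lies in the square of [M], which [delta] maps to [MD], one has
    [delta (delta x) = 0] modulo [MD], and the binomial expansion of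
    [(1 + delta) ^ k] stops at the linear term. *)
Let iter_sigma k x : MD (iter k sigma x - x - delta x *+ k).
Proof.
elim: k => [|k IHk] /=; first by rewrite subrr subr0; apply: ideal0 idMD.
set e := _ - _ in IHk.
have -> : sigma (iter k sigma x) - x - delta x *+ k.+1 =
    (e + delta e) + delta (delta x *+ k).
  have -> : sigma (iter k sigma x) = iter k sigma x + delta (iter k sigma x).
    by rewrite /delta addrC subrK.
  have -> : delta (iter k sigma x) = delta e + delta (delta x *+ k) + delta x.
    by rewrite -!deltaD !subrK.
  rewrite mulrS {2}/e; move: (delta e) (delta (delta x *+ k)) => de ddx.
  by ring.
have MDk y : D y -> MD (delta y) by move=> Dy; exact: delta_square (D_square Dy).
apply: (idealD idMD); first apply: (idealD idMD) => //.
  exact: MDk (idprod_subr idD IHk).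
apply: MDk; rewrite -mulr_natl; apply: idealMl idD _ _ _; exact: D_delta.
Qed.

(** If [sigma ^ q = 1] then [q * delta x] vanishes modulo [MD], and so does
    [p * delta x] because [p] is in [M]. Hence [D = M D], and Nakayama's lemma
    applies. *)
Lemma annihilated_displacement p q : prime p -> prime q -> p != q -> M p%:R ->
  (forall x, iter q sigma x = x) ->
  exists2 e, M e & forall x, (1 - e) * (sigma x - x) = 0.
Proof.
move=> p_pr q_pr pq Mp sigma_q.
have MD_delta x : MD (delta x).
  have qd : MD (delta x *+ q).
    rewrite -[_ *+ _]opprK; apply: (idealN idMD).
    by have := iter_sigma q x; rewrite sigma_q subrr sub0r.
  have pd : MD (delta x *+ p).
    by rewrite -mulr_natl; exact: idprod_mul Mp (D_delta x).
  have := prime_gt0 q_pr; case/(egcdnP p) => u v.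
  have -> : gcdn q p = 1%N.
    by apply/eqP; rewrite -/(coprime q p) prime_coprime // dvdn_prime2 // eq_sym.
  move=> uv _; rewrite -[delta x]mulr1n.
  have -> : delta x *+ 1 = u%:R * (delta x *+ q) - v%:R * (delta x *+ p).
    by rewrite !mulr_natl -!mulrnA mulnC uv mulnC mulrnDr addrAC subrr add0r.
  by apply: (idealB idMD); apply: (idealMl idMD).
have [||e Me eD] := @nakayama _ M l 1 idM.
- by rewrite subrr; apply: ideal0 idM.
- by move=> _ /mapP[a _ ->]; rewrite mul1r; exact: MD_delta.
- by exists e => // x; apply/eD/D_delta.
Qed.

End TrivialModSquare.

(** * Virtually torsion-free groups *)

(** For a prime [q] dividing [n], the power [g ^+ (n %/ q)] either has order
    [q] or is trivial; in the latter case [n] is replaced by [n %/ q]. *)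
Lemma exists_prime_order (G : groupType) (K : {pred G}) g n :
  group_closed K -> g \in K -> (0 < n)%N -> (g ^+ n)%g = 1%g -> g <> 1%g ->
  exists q h, [/\ prime q, h \in K, (h ^+ q)%g = 1%g & h <> 1%g].
Proof.
move=> [K1 KV].
have KM x y : x \in K -> y \in K -> (x * y)%g \in K.
  move=> Kx Ky; have KyV : (y^-1)%g \in K by rewrite -[(y^-1)%g]mul1g; apply: KV.
  by rewrite -[y]invgK; apply: KV.
have KX x m : x \in K -> (x ^+ m)%g \in K.
  by move=> Kx; elim: m => [|m IHm]; rewrite ?expg0 // expgS; apply: KM.
elim/ltn_ind: n g => n IHn g Kg n_gt0 gn g1.
have n_gt1 : (1 < n)%N.
  rewrite ltn_neqAle n_gt0 andbT; apply/eqP => n1; apply: g1.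
  by rewrite -gn -n1 expg1.
have q_pr := pdiv_prime n_gt1; set q := pdiv n in q_pr.
have qn : (n %/ q * q)%N = n by rewrite divnK // pdiv_dvd.
have [gq|gq] := eqVneq (g ^+ (n %/ q))%g 1%g.
  apply: (IHn (n %/ q)%N _ g) => //.
    by rewrite ltn_Pdiv // prime_gt1.
  by rewrite divn_gt0 ?prime_gt0 // dvdn_leq // pdiv_dvd.
exists q, (g ^+ (n %/ q))%g; split=> //; first exact: KX.
  by rewrite -expgnA qn.
exact/eqP.
Qed.

(** For two primes [p1] and [p2] pick
    separating ideals [M1] and [M2]; the elements acting trivially modulo the
    squares of both form a subgroup of finite index. If one of them has prime
    order [q], then [q] differs from [p1] or [p2], and the corresponding [M]
    contains some [e] with [1 - e] annihilating all [g x - x], against the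
    choice of [M]. *)
Theorem virtually_torsion_free_action (G : groupType) (H : {pred G})
    (A : comPzRingType) (s : seq A) (act : G -> A -> A) :
  generates s -> no_additive_torsion A -> group_closed H ->
  (forall x, act 1%g x = x) ->
  {in H &, forall g h x, act (g * h)%g x = act g (act h x)} ->
  {in H, forall g, zmod_morphism (act g)} ->
  {in H, forall g, monoid_morphism (act g)} ->
  {in H, forall g, (forall x, act g x = x) -> g = 1%g} ->
  virtually_torsion_free H.
Proof.
move=> gen_s tfA [H1 HV] act1 actM actB actX faithful.
have HI g : g \in H -> (g^-1)%g \in H.
  by move=> Hg; rewrite -[(g^-1)%g]mul1g; apply: HV.
have HM g h : g \in H -> h \in H -> (g * h)%g \in H.
  by move=> Hg Hh; rewrite -[h]invgK; apply: HV => //; apply: HI.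
have noethA := noetherian_fg_ring gen_s.
have ideal_zero : is_ideal (fun x : A => x = 0).
  by split=> [//|x y -> ->|a x ->]; rewrite ?addr0 ?mulr0.
have [N N_gt0 sepN] := separable_ideal gen_s ideal_zero.
have big_prime m : (N <= m)%N -> exists2 p, (m < p)%N & prime p /\ ~~ (p %| N)%N.
  move=> Nm; have [p mp p_pr] := prime_above m; exists p => //; split=> //.
  by apply/negP => /(dvdn_leq N_gt0); rewrite leqNgt (leq_ltn_trans Nm).
have [p1 Np1 [p1_pr p1N]] := big_prime N (leqnn N).
have [p2 p12 [p2_pr p2N]] := big_prime p1 (ltnW Np1).
have [M1 [idM1 fM1 M1p sep1]] := sepN p1 p1_pr p1N.
have [M2 [idM2 fM2 M2p sep2]] := sepN p2 p2_pr p2N.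
pose J x := idprod M1 M1 x /\ idprod M2 M2 x.
have idJ : is_ideal J by apply: ideal_cap; apply: idprod_ideal.
have [T [f fJ]] : cofinite J by apply: cofiniteI; apply: cofinite_square.
pose K : {pred G} := [pred g | (g \in H) && `[< forall x, J (act g x - x) >]].
have KP g : reflect (g \in H /\ forall x, J (act g x - x)) (g \in K).
  by apply: (iffP andP) => -[Hg /asboolP].
have K_closed : group_closed K.
  split; first by apply/KP; split=> // x; rewrite act1 subrr; apply: ideal0 idJ.
  move=> g h /KP[Hg Jg] /KP[Hh Jh]; apply/KP; split=> [|x]; first exact: HV.
  rewrite actM //; last exact: HI.
  set y := act h^-1%g x.
  have -> : x = act h y by rewrite /y -actM ?mulgV ?act1 //; apply: HI.
  have -> : act g y - act h y = (act g y - y) - (act h y - y) by ring.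
  exact: idealB.
exists K; split=> //; first by move=> g /KP[].
- (* If [g^-1] and [t^-1] agree on [s] modulo [J], they agree on [A] modulo [J],
     and evaluating both at [act g x] shows that [t^-1 * g] is in [K]. Images
     under the inverses are recorded because they give left cosets without
     requiring that [J] be stable under [H]. *)
  pose theta g := [ffun i : 'I_(size s) => f (act g^-1%g s`_i)].
  have exrep v : exists g, g \in H /\
      ((exists2 h, h \in H & theta h = v) -> theta g = v).
    have [[h Hh hv]|nv] := pselect (exists2 h, h \in H & theta h = v).
      by exists h.
    by exists 1%g; split.
  have [rep repP] := choice exrep.
  exists (map rep (enum {: {ffun 'I_(size s) -> T}})).
  split=> [_ /mapP[v _ ->]|g Hg]; first by case: (repP v).
  have [Ht /(_ (ex_intro2 _ _ g Hg erefl)) tg] := repP (theta g).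
  exists (rep (theta g)); first by apply: map_f; rewrite mem_enum.
  set t := rep _ in Ht tg *; have [HgV HtV] := (HI g Hg, HI t Ht).
  have Jgt x : J (act g^-1%g x - act t^-1%g x).
    move: x; apply: (generates_ind gen_s) => [|x y Jx Jy|x y Jx Jy|x sx].
    + by rewrite (actX _ HgV).1 (actX _ HtV).1 subrr; apply: ideal0 idJ.
    + rewrite (actB _ HgV) (actB _ HtV).
      set a := act _ x in Jx *; set b := act _ y in Jy *.
      set c := act _ x in Jx *; set d := act _ y in Jy *.
      by have -> : a - b - (c - d) = a - c - (b - d); [ring | apply: idealB].
    + rewrite (actX _ HgV).2 (actX _ HtV).2.
      set a := act _ x in Jx *; set b := act _ y in Jy *.
      set c := act _ x in Jx *; set d := act _ y in Jy *.
      have -> : a * b - c * d = b * (a - c) + c * (b - d) by ring.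
      by apply: (idealD idJ); apply: (idealMl idJ).
    + have si : (index x s < size s)%N by rewrite index_mem.
      have /ffunP/(_ (Ordinal si)) := tg; rewrite !ffunE /= nth_index // => tgx.
      exact: fJ.
  apply/KP; split=> [|x]; first exact: HM.
  have gK : act g^-1%g (act g x) = x by rewrite -actM // mulVg act1.
  by rewrite actM // -{2}gK -opprB; apply: idealN.
- move=> g Kg n n_gt0 gn; apply: contrapT => g1.
  have [q [h [q_pr Kh hq h1]]] := exists_prime_order K_closed Kg n_gt0 gn g1.
  have [Hh Jh] := KP _ Kh.
  have [x hx] : exists x, act h x - x <> 0.
    apply/existsNP => h0; apply: h1; apply: faithful => // x.
    by apply/eqP; rewrite -subr_eq0; apply/eqP.
  have HX m : (h ^+ m)%g \in H.
    by elim: m => [|m IHm]; rewrite ?expg0 // expgS; apply: HM.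
  have iter_h m y : iter m (act h) y = act (h ^+ m)%g y.
    elim: m => [|m IHm]; first by rewrite expg0 act1.
    by rewrite expgS actM //= IHm.
  have sep_false p M : separating p (fun x => x = 0) M -> prime p -> p != q ->
      (forall x, idprod M M (act h x - x)) -> False.
    move=> [idM _ Mp sepM] p_pr pq Mh.
    have [|e Me eP] := annihilated_displacement gen_s idM (actB _ Hh) (actX _ Hh)
      Mh p_pr q_pr pq Mp.
      by move=> y; rewrite iter_h hq act1.
    apply: (sepM (act h x - x) _ e Me (eP x)) => m m_gt0 /(tfA _ _ m_gt0).
    exact: hx.
  have [p1q|p1q] := eqVneq p1 q; last first.
    by apply: (sep_false p1 M1) => // y; case: (Jh y).
  apply: (sep_false p2 M2) => //; last by move=> y; case: (Jh y).
  by rewrite -p1q; move: p12; rewrite ltn_neqAle eq_sym => /andP[].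
Qed.

(** * Descent to a finitely generated subring *)

Section GeneratedSubring.
Context (A : comPzRingType) (t : seq A).

Lemma subring_gen_mem x : x \in t -> subring_gen t x.
Proof. by move=> tx B _; apply. Qed.

Lemma subring_gen1 : subring_gen t 1.
Proof. by move=> B []. Qed.

Lemma subring_genB x y :
  subring_gen t x -> subring_gen t y -> subring_gen t (x - y).
Proof.
move=> gx gy B clB tB; case: (clB) => _ BB _.
by apply: BB; [apply: gx | apply: gy].
Qed.

Lemma subring_genM x y :
  subring_gen t x -> subring_gen t y -> subring_gen t (x * y).
Proof.
move=> gx gy B clB tB; case: (clB) => _ _ BM.
by apply: BM; [apply: gx | apply: gy].
Qed.

Definition subring_pred : {pred A} := [pred x | `[< subring_gen t x >]].

Lemma subring_predP x : reflect (subring_gen t x) (x \in subring_pred).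
Proof. exact: asboolP. Qed.

Lemma subring_pred_closed : subring_closed subring_pred.
Proof.
split=> [|x y|x y]; first by apply/subring_predP/subring_gen1.
  by move=> /subring_predP gx /subring_predP gy; apply/subring_predP/subring_genB.
by move=> /subring_predP gx /subring_predP gy; apply/subring_predP/subring_genM.
Qed.

Record subring_of := SubringOf {
  subring_val :> A; _ : subring_val \in subring_pred }.

HB.instance Definition _ := [isSub for subring_val].
HB.instance Definition _ := [Choice of subring_of by <:].
HB.instance Definition _ :=
  GRing.SubChoice_isSubComPzRing.Build A subring_pred subring_of subring_pred_closed.

Lemma generates_subring_of : exists s : seq subring_of, generates s.
Proof.
exists (pmap insub t) => x B [B1 BB BM] sB.
suff [z [/val_inj <- //]] : exists z : subring_of, val z = val x /\ z \in B.
have /subring_predP := valP x.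
move: (val x); apply: subring_gen_ind =>
  [|y z [y' [<- By]] [z' [<- Bz]]|y z [y' [<- By]] [z' [<- Bz]]|y ty].
- by exists 1.
- by exists (y' - z'); split; [|apply: BB].
- by exists (y' * z'); split; [|apply: BM].
- have gy : y \in subring_pred by apply/subring_predP/subring_gen_mem.
  by exists (SubringOf gy); split=> //; apply: sB; rewrite mem_pmap_sub.
Qed.

Lemma no_additive_torsion_subring_of :
  no_additive_torsion A -> no_additive_torsion subring_of.
Proof.
move=> tfA n a n_gt0 na; apply: val_inj; rewrite raddf0; apply: (tfA n) => //.
by rewrite -(raddfMn (val : {additive subring_of -> A})) na raddf0.
Qed.

End GeneratedSubring.

Lemma subring_gen_sub (A : comPzRingType) (t t' : seq A) x :
  {subset t <= t'} -> subring_gen t x -> subring_gen t' x.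
Proof. by move=> tt' gx B clB t'B; apply: gx => // y /tt'; apply: t'B. Qed.

Section AlgebraAutomorphisms.
Context (Phi A : comPzRingType) (iota : {rmorphism Phi -> A}) (s : seq A).
Hypothesis gen_s : forall B : {pred A}, subring_closed B ->
  (forall c x, x \in B -> iota c * x \in B) -> {subset s <= B} ->
  forall x, x \in B.
Implicit Types (g h : algAut iota) (cs : seq Phi).

Let base cs := s ++ map iota cs.

(** Each element of [A] is a polynomial in the generators, and so involves
    only finitely many scalars. *)
Let mem_base (ys : seq A) :
  exists cs, forall y, y \in ys -> subring_gen (base cs) y.
Proof.
have base_sub cs cs' : {subset cs <= cs'} -> {subset base cs <= base cs'}.
  move=> cc' x; rewrite !mem_cat => /orP[->//|/mapP[c cs_c ->]].
  by rewrite map_f ?orbT //; apply: cc'.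
have catl cs cs' : {subset base cs <= base (cs ++ cs')}.
  by apply: base_sub => c cs_c; rewrite mem_cat cs_c.
have catr cs cs' : {subset base cs' <= base (cs ++ cs')}.
  by apply: base_sub => c cs_c; rewrite mem_cat cs_c orbT.
have one y : exists cs, subring_gen (base cs) y.
  pose B := [pred y | `[< exists cs, subring_gen (base cs) y >]].
  apply/asboolP; apply: (gen_s (B := B)).
  - split=> [|x z /asboolP[c gx] /asboolP[d gz]|x z /asboolP[c gx] /asboolP[d gz]].
    + by apply/asboolP; exists [::]; apply: subring_gen1.
    + apply/asboolP; exists (c ++ d).
      apply: subring_genB; first exact: subring_gen_sub gx.
      exact: subring_gen_sub gz.
    + apply/asboolP; exists (c ++ d).
      apply: subring_genM; first exact: subring_gen_sub gx.
      exact: subring_gen_sub gz.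
  - move=> c x /asboolP[cs gx]; apply/asboolP; exists (c :: cs); apply: subring_genM.
      by apply: subring_gen_mem; rewrite mem_cat map_f ?mem_head ?orbT.
    by apply: subring_gen_sub gx; apply: (catr [:: c]).
  - move=> x sx; apply/asboolP; exists [::].
    by apply: subring_gen_mem; rewrite mem_cat sx.
elim: ys => [|y ys [cs gys]]; first by exists [::].
have [c gy] := one y; exists (c ++ cs) => z; rewrite inE => /predU1P[->|/gys gz].
  exact: subring_gen_sub gy.
exact: subring_gen_sub gz.
Qed.

Lemma algAutB g x y : g (x - y) = g x - g y.
Proof. by case: (algAutP g) => + _ _ _; apply. Qed.

Lemma algAut1 g : g 1 = 1.
Proof. by case: (algAutP g) => _ [+ _] _ _; apply. Qed.

Lemma algAutM g x y : g (x * y) = g x * g y.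
Proof. by case: (algAutP g) => _ [_ +] _ _; apply. Qed.

Lemma algAut_scalar g c : g (iota c) = iota c.
Proof.
by case: (algAutP g) => _ _ gZ _; rewrite -[iota c]mulr1 gZ algAut1.
Qed.

Let preserves_base cs g : (forall a, a \in s -> subring_gen (base cs) (g a)) ->
  forall x, subring_gen (base cs) x -> subring_gen (base cs) (g x).
Proof.
move=> gs; apply: subring_gen_ind => [|x y gx gy|x y gx gy|x].
- by rewrite algAut1; apply: subring_gen1.
- by rewrite algAutB; apply: subring_genB.
- by rewrite algAutM; apply: subring_genM.
rewrite mem_cat => /orP[/gs //|/mapP[c cs_c ->]].
by rewrite algAut_scalar; apply: subring_gen_mem; rewrite mem_cat map_f ?orbT.
Qed.

Lemma algAut_eq1 g : (forall a, a \in s -> g a = a) -> g = 1%g.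
Proof.
move=> ga; apply: algAut_ext => x; apply/eqP.
apply: (gen_s (B := [pred x | g x == x])) => [|c y /eqP gy|a /ga /eqP //].
  split=> [|y z /eqP gy /eqP gz|y z /eqP gy /eqP gz]; apply/eqP.
  - exact: algAut1.
  - by rewrite algAutB gy gz.
  - by rewrite algAutM gy gz.
by apply/eqP; rewrite algAutM algAut_scalar gy.
Qed.

(** The finitely many scalars which occur when the generators of [H] and
    their inverses are applied to the generators of [A] span, together with
    the latter, a finitely generated ring on which [H] acts faithfully. *)
Lemma virtually_torsion_free_fg (H : {pred algAut iota}) :
  no_additive_torsion A -> group_closed H -> finitely_generated_subgroup H ->
  virtually_torsion_free H.
Proof.
move=> tfA clH [fs [_ genH]].
pose ys := [seq (g : algAut iota) a | g <- fs ++ [seq (f^-1)%g | f <- fs], a <- s].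
have [cs gys] := mem_base ys.
pose t := base cs.
pose K : {pred algAut iota} := [pred g : algAut iota |
  `[< forall x, subring_gen t x ->
      subring_gen t (g x) /\ subring_gen t ((g^-1)%g x) >]].
have KP (g : algAut iota) : reflect (forall x, subring_gen t x ->
    subring_gen t (g x) /\ subring_gen t ((g^-1)%g x)) (g \in K).
  exact: asboolP.
have HK : {subset H <= K}.
  apply: genH => [|g fs_g].
    split=> [|g h /KP Kg /KP Kh]; apply/KP => x tx; first by rewrite invg1.
    rewrite invgM invgK; split.
      by have [_ /Kg[]] := Kh _ tx.
    by have [_ /Kh[]] := Kg _ tx.
  apply/KP => x tx; split; apply: preserves_base tx => a sa; apply: gys.
    by apply/allpairsP; exists (g, a); rewrite mem_cat fs_g.
  apply/allpairsP; exists ((g^-1)%g, a); split=> //=.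
  by rewrite mem_cat; apply/orP; right; apply/mapP; exists g.
have Ht g x : g \in H -> x \in subring_pred t -> g x \in subring_pred t.
  by move=> /HK/KP Kg /subring_predP/Kg[? _]; apply/subring_predP.
pose act g (x : subring_of t) : subring_of t := insubd 0 (g (val x)).
have actE g x : g \in H -> val (act g x) = g (val x).
  by move=> Hg; rewrite val_insubd Ht // (valP x).
have [s0 gen_s0] := generates_subring_of t.
case: (clH) => H1 HV.
have HM g h : g \in H -> h \in H -> (g * h)%g \in H.
  by move=> Hg Hh; rewrite -[h]invgK -[(h^-1)%g]mul1g; apply: (HV) => //; apply: HV.
apply: (virtually_torsion_free_action (act := act) gen_s0) => //.
- exact: no_additive_torsion_subring_of.
- by move=> x; apply: val_inj; rewrite actE.
- by move=> g h Hg Hh x; apply: val_inj; rewrite !actE //; apply: HM.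
- by move=> g Hg x y; apply: val_inj; rewrite raddfB /= !actE // raddfB algAutB.
- move=> g Hg; split=> [|x y]; apply: val_inj; rewrite !actE //.
    by rewrite rmorph1 algAut1.
  by rewrite rmorphM algAutM rmorphM /= !actE.
- move=> g Hg g1; apply: algAut_eq1 => a sa.
  have ta : a \in subring_pred t.
    by apply/subring_predP/subring_gen_mem; rewrite mem_cat sa.
  by have /(congr1 val) := g1 (SubringOf ta); rewrite actE.
Qed.

End AlgebraAutomorphisms.

Lemma subring_closed_int (A : comPzRingType) (iota : {rmorphism int -> A})
    (B : {pred A}) c x : subring_closed B -> x \in B -> iota c * x \in B.
Proof.
case=> B1 BB BM Bx; apply: BM => //.
have B0 : 0 \in B by rewrite -(subrr 1) BB.
have BN y : y \in B -> - y \in B by move=> By; rewrite -[- y]sub0r BB.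
have Bn n : n%:R \in B.
  elim: n => // n Bn; rewrite -natr1 -[X in _ + X]opprK.
  by apply: (BB) => //; exact: BN.
rewrite -[c]intz rmorph_int; case: c => n; first exact: Bn.
by rewrite NegzE mulrNz; apply: BN; apply: Bn.
Qed.

Theorem theorem1p1 :
  (forall (Phi A : comPzRingType) (iota : {rmorphism Phi -> A}),
     finitely_generated_alg iota ->
     no_additive_torsion A ->
     forall H : {pred algAut iota},
       group_closed H -> finitely_generated_subgroup H ->
       virtually_torsion_free H)
  /\
  (forall (A : comPzRingType) (iota : {rmorphism int -> A}),
     finitely_generated_alg iota ->
     no_additive_torsion A ->
     virtually_torsion_free (predT : {pred algAut iota})).
Proof.
split=> [Phi A iota [s gen_s] tfA H|A iota [s gen_s] tfA].
  move=> clH fgH; exact (virtually_torsion_free_fg gen_s tfA clH fgH).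
have gen_s_ring : generates s.
  move=> x B clB sB; apply: gen_s => // c y; exact: subring_closed_int clB.
pose act (g : algAut iota) : A -> A := g.
apply: (virtually_torsion_free_action (act := act) gen_s_ring) => //.
- by move=> g _ x y; exact: algAutB.
- by move=> g _; split=> [|x y]; [exact: algAut1 | exact: algAutM].
- by move=> g _ g1; apply: (algAut_eq1 gen_s) => a _; exact: g1.
Qed.
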